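(* Let $T$ be a degenerate exactly-solvable operator of order $k$. Then $r_n\to\infty$ when $n\to\infty$.
   Context: Here $D=d/dz$. A degenerate exactly-solvable operator of order $k$ is a linear differential operator $T=\sum_{j=1}^{k}Q_jD^j$ with polynomial coefficients $Q_j\in\mathbb{C}[z]$, $Q_k\not\equiv 0$, such that $\deg Q_j\leq j$ for all $j$, with equality for at least one $j$, and $\deg Q_k<k$. For all sufficiently large integers $n$ there exist a unique constant $\lambda_n$ and a unique monic polynomial $p_n$ of degree $n$ with $T(p_n)=\lambda_n p_n$ (the $n$th degree eigenpolynomial of $T$). For such $n$, $r_n=\max\{|z|:p_n(z)=0\}$ denotes the largest modulus of all roots of $p_n$. *)

(* Defs.v *)
From HB Require Import structures.
From mathcomp Require Import all_boot all_order all_algebra.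
From mathcomp Require Import complex.
From mathcomp Require Import all_classical all_reals all_analysis.

Set Implicit Arguments.
Unset Strict Implicit.
Unset Printing Implicit Defensive.

Import Order.TTheory GRing.Theory Num.Theory.
Import numFieldNormedType.Exports.

Local Open Scope classical_set_scope.
Local Open Scope ring_scope.
Local Open Scope complex_scope.

(* T = \sum_(1 <= j <= k) Q_j D^j; the values Q 0 and Q j for j > k are
   irrelevant. *)
Definition diffop (R : realType) (k : nat) (Q : nat -> {poly R[i]})
    (p : {poly R[i]}) : {poly R[i]} :=
  \sum_(1 <= j < k.+1) Q j * p^`(j).

(* Since [size q] is [deg q + 1] for q != 0 and [size 0 = 0], [deg q <= j] is
   [size q <= j.+1], [deg q = j] is [size q = j.+1] and [deg q < k] is
   [size q <= k]. *)
Definition exactly_solvable (R : realType) (k : nat)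
    (Q : nat -> {poly R[i]}) : Prop :=
  [/\ Q k != 0,
      forall j : nat, (1 <= j <= k)%N -> (size (Q j) <= j.+1)%N
    & exists2 j : nat, (1 <= j <= k)%N & size (Q j) = j.+1].

Definition degenerate_exactly_solvable (R : realType) (k : nat)
    (Q : nat -> {poly R[i]}) : Prop :=
  exactly_solvable k Q /\ (size (Q k) <= k)%N.

Definition eigenpolynomial (R : realType) (k : nat) (Q : nat -> {poly R[i]})
    (n : nat) (p : {poly R[i]}) : Prop :=
  [/\ p \is monic, size p = n.+1
    & exists lambda : R[i], diffop k Q p = lambda *: p].

(* The real-valued modulus [normc] is used because [`|z|] lives in R[i]. *)
Definition max_root_modulus (R : realType) (p : {poly R[i]}) : R :=
  sup [set ComplexField.Normc.normc z | z in [set z : R[i] | root p z]].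

(* The supremum above is a maximum for nonconstant p. *)
Lemma max_root_modulusP (R : realType) (p : {poly R[i]}) :
  (1 < size p)%N ->
  (exists2 z, root p z & ComplexField.Normc.normc z = max_root_modulus p) /\
  (forall z, root p z -> ComplexField.Normc.normc z <= max_root_modulus p).
Proof.
move=> sp; have p0 : p != 0 by rewrite -size_poly_gt0 ltnW.
have [s ps] := closed_field_poly_normal p.
have rs z : root p z = (z \in s).
  by rewrite ps rootZ ?lead_coef_eq0// root_prod_XsubC.
have [z0 rz0] : exists z, root p z.
  by apply/closed_rootP; rewrite neq_ltn sp orbT.
have [z rz zmax] : exists2 z, z \in s &
    forall w, w \in s ->
      ComplexField.Normc.normc w <= ComplexField.Normc.normc z.
  have : s != [::] by apply: contraTneq rz0 => s0; rewrite rs s0.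
  elim: {ps rs rz0} s => [//|a [_ _|b s IH _]].
    by exists a; rewrite ?mem_head// => w; rewrite inE => /eqP ->.
  have [//|z zs zmax] := IH.
  have [az|/ltW za] := leP (ComplexField.Normc.normc a)
                           (ComplexField.Normc.normc z).
    exists z; first by rewrite inE zs orbT.
    by move=> w; rewrite inE => /orP[/eqP ->//|/zmax].
  exists a; first by rewrite mem_head.
  by move=> w; rewrite inE => /orP[/eqP ->//|/zmax /le_trans]; apply.
have ub : ubound [set ComplexField.Normc.normc w | w in
    [set w : R[i] | root p w]] (ComplexField.Normc.normc z).
  by move=> _ [w /= rw <-]; apply: zmax; rewrite -rs.
suff -> : max_root_modulus p = ComplexField.Normc.normc z.
  by split=> [|w rw]; [exists z; rewrite ?rs | apply: zmax; rewrite -rs].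
apply/eqP; rewrite eq_le; apply/andP; split.
  by apply: ge_sup => //; exists (ComplexField.Normc.normc z0), z0.
by apply: ub_le_sup; [exists (ComplexField.Normc.normc z) | exists z; rewrite //= rs].
Qed.

(* Main.v *)
Require Import Defs.
From HB Require Import structures.
From mathcomp Require Import all_boot all_order all_algebra.
From mathcomp Require Import complex.
From mathcomp Require Import ring zify.
From mathcomp Require Import all_classical all_reals all_analysis.

(* If every root of q has modulus less than |z|, then z q'(z) / q(z) is a sum of
   deg q terms z / (z - a), each of real part at least 1/2, so
   deg q |q(z)| <= 2 |z| |q'(z)|. In particular q'(z) != 0, so the roots of q' lie
   in the same disc (Gauss-Lucas) and the estimate iterates: for j < k,
   (n - k + 1) |p_n^(j)(z)| <= C |p_n^(k)(z)| with C independent of n. The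
   eigenvalue lambda_n is a combination of the falling factorials n^_j with j < k,
   because deg Q_k < k, so (n - k + 1) |lambda_n p_n(z)| <= C |p_n^(k)(z)| as well.
   If r_n < A, fix z with |z| > A and Q_k(z) != 0: the equation at z then gives
   (n - k + 1) |Q_k(z)| <= C, which bounds n. *)

Set Implicit Arguments.
Unset Strict Implicit.
Unset Printing Implicit Defensive.

Import Order.TTheory GRing.Theory Num.Theory.
Import numFieldNormedType.Exports.

Local Open Scope classical_set_scope.
Local Open Scope ring_scope.
Local Open Scope complex_scope.

(** For [u = z / (z - a)], [u - 1 = a / (z - a)] has modulus at most that of [u]; expanding the
    squared moduli turns this into twice the real part of [u] being at least 1. *)
Lemma addC_conj_div_subr_ge1 (C : numClosedFieldType) (z a : C) :
  `|a| < `|z| -> 1 <= z / (z - a) + Num.conj (z / (z - a)).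
Proof.
move=> az; have za0 : z - a != 0.
  by rewrite subr_eq0; apply: contraTneq az => ->; rewrite ltxx.
set u := z / (z - a).
have hu : `|u - 1| <= `|u|.
  have -> : u - 1 = a / (z - a) by rewrite /u; field.
  by rewrite !normrM ler_wpM2r// ltW.
have : `|u - 1| ^+ 2 <= `|u| ^+ 2 by rewrite lerXn2r// nnegrE.
rewrite !normCK -[_ <= u * _]subr_ge0 -[1 <= _]subr_ge0.
suff -> : u * Num.conj u - (u - 1) * Num.conj (u - 1) = u + Num.conj u - 1.
  by [].
by rewrite rmorphB rmorph1; ring.
Qed.

(* [w] is [\sum_(a <- s) z / (z - a)], the logarithmic derivative times [z]. *)
Lemma horner_deriv_prod_XsubC (C : numClosedFieldType) (s : seq C) (z : C) :
    (forall a, a \in s -> `|a| < `|z|) ->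
  let q := \prod_(a <- s) ('X - a%:P) in
  exists2 w, z * q^`().[z] = q.[z] * w & (size s)%:R <= w + Num.conj w.
Proof.
elim: s => [_|a s IH sz] /=.
  by exists 0; rewrite ?rmorph0 ?addr0// big_nil derivC horner0 !mulr0.
have [|w qw sw] := IH; first by move=> b bs; apply: sz; rewrite inE bs orbT.
have az : `|a| < `|z| by apply: sz; rewrite mem_head.
have za0 : z - a != 0.
  by rewrite subr_eq0; apply: contraTneq az => ->; rewrite ltxx.
exists (z / (z - a) + w); last first.
  rewrite rmorphD/= addrACA -add1n natrD lerD//.
  exact: addC_conj_div_subr_ge1.
rewrite big_cons derivM !hornerE/= derivXsubC !hornerE.
rewrite mulrDr mulrCA qw; field.
exact: za0.
Qed.

Lemma norm_deriv_ge (C : numClosedFieldType) (p : {poly C}) (z : C) :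
    (forall a, root p a -> `|a| < `|z|) ->
  (size p).-1%:R * `|p.[z]| <= 2 * `|z| * `|p^`().[z]|.
Proof.
move=> pz; have [->|p0] := eqVneq p 0.
  by rewrite size_poly0 deriv0 horner0 normr0 !mulr0.
have [s ps] := closed_field_poly_normal p.
have lp0 : lead_coef p != 0 by rewrite lead_coef_eq0.
have [|w qw sw] := @horner_deriv_prod_XsubC C s z.
  by move=> a sa; apply: pz; rewrite ps rootZ// root_prod_XsubC.
rewrite {1}ps size_scale// size_prod_XsubC/=.
have zpw : z * p^`().[z] = p.[z] * w.
  by rewrite ps derivZ !hornerZ mulrCA qw mulrA.
(* With [p.[z]] factored out, it remains that the degree, at most [w + Num.conj w], is at most twice
   the modulus of [w]. *)
rewrite -mulrA -normrM zpw normrM mulrCA mulrC ler_wpM2l//.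
apply: (le_trans sw); rewrite mulr2n mulrDl mul1r -{2}(norm_conjC w).
apply: le_trans (ler_normD _ _).
by rewrite ger0_norm// (le_trans _ sw)// ler0n.
Qed.

Lemma size_derivC (C : numClosedFieldType) (p : {poly C}) :
  size p^`() = (size p).-1.
Proof.
have [sp|sp] := leqP (size p) 1.
  by rewrite [p]size1_polyC// derivC size_poly0 size_polyC; case: eqP.
have [m sm] : exists m, size p = m.+2 by exists (size p).-2; lia.
rewrite sm /=; apply/eqP; rewrite eqn_leq; apply/andP; split.
  by apply/leq_sizeP => j mj; rewrite coef_deriv nth_default ?mul0rn// sm.
rewrite ltnNge; apply/negP => /leq_sizeP /(_ _ (leqnn _)) /eqP.
rewrite coef_deriv mulrn_eq0 /=.
have -> : p`_m.+1 = lead_coef p by rewrite /lead_coef sm.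
by rewrite lead_coef_eq0 -size_poly_eq0 sm.
Qed.

(** At a root [a] of the derivative outside the disc, [norm_deriv_ge] would force [p.[a] = 0]. *)
Lemma root_deriv_norm_lt (C : numClosedFieldType) (p : {poly C}) (r : C) :
    (1 < size p)%N -> (forall a, root p a -> `|a| < r) ->
  forall a, root p^`() a -> `|a| < r.
Proof.
move=> sp pr a /rootP p'a.
(* The order on [C] is partial: [r] must be real before its comparison can be negated. *)
have r_real : r \is Num.real.
  have [b pb] : exists b, root p b by apply/closed_rootP; rewrite neq_ltn sp orbT.
  exact/gtr0_real/(le_lt_trans (normr_ge0 b))/pr.
rewrite real_ltNge//; apply/negP => ra.
have pa : forall b, root p b -> `|b| < `|a|.
  by move=> b /pr /lt_le_trans; apply.
have := norm_deriv_ge pa; rewrite p'a normr0 mulr0.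
have s0 : (0 < (size p).-1)%N by rewrite -subn1 subn_gt0.
rewrite lt_geF// mulr_gt0// ?ltr0n ?normr_gt0//.
by apply/negP => /(pa a); rewrite ltxx.
Qed.

Lemma size_derivnC (C : numClosedFieldType) (p : {poly C}) (d : nat) :
  size p^`(d) = (size p - d)%N.
Proof. by elim: d => [|d IH]; rewrite ?subn0// derivnS size_derivC IH; lia. Qed.

Lemma root_derivn_norm_lt (C : numClosedFieldType) (p : {poly C}) (r : C)
    (d : nat) :
    (d < size p)%N -> (forall a, root p a -> `|a| < r) ->
  forall a, root p^`(d) a -> `|a| < r.
Proof.
elim: d => [//|d IH] dp pr; rewrite derivnS; apply: root_deriv_norm_lt.
  by rewrite size_derivnC; lia.
by apply: IH => //; apply: ltnW.
Qed.

(** Each of the [d] uses of [norm_deriv_ge] contributes the degree of the current derivative; these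
    degrees multiply to the falling factorial. *)
Lemma norm_derivn_ge (C : numClosedFieldType) (p : {poly C}) (z : C)
    (j d : nat) :
    (j + d < size p)%N -> (forall a, root p a -> `|a| < `|z|) ->
  (((size p).-1 - j) ^_ d)%:R * `|p^`(j).[z]| <=
    (2 * `|z|) ^+ d * `|p^`(j + d).[z]|.
Proof.
move=> + pz; elim: d => [|d IH] jdp; first by rewrite ffactn0 addn0 expr0.
rewrite ffactnSr natrM mulrAC exprSr addnS derivnS.
apply: le_trans (ler_wpM2r (ler0n _ ((size p).-1 - j - d)) (IH ltac:(lia))) _.
rewrite -!mulrA ler_wpM2l// mulrC mulrA.
have -> : ((size p).-1 - j - d)%N = (size p^`(j + d)).-1.
  by rewrite size_derivnC; lia.
by apply/norm_deriv_ge/root_derivn_norm_lt => //; lia.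
Qed.

Lemma coef_mul_derivn (C : nzSemiRingType) (q p : {poly C}) (j n : nat) :
    (size q <= j.+1)%N -> (size p <= n.+1)%N -> (j <= n)%N ->
  (q * p^`(j))`_n = q`_j * (n ^_ j)%:R * p`_n.
Proof.
move=> sq sp jn; have jn1 : (j < n.+1)%N by [].
rewrite coefM (bigD1 (Ordinal jn1))//= big1 ?addr0; last first.
  (* Below index [j] the coefficient of [p] lies beyond its degree; above [j], that of [q] does. *)
  move=> i; rewrite -val_eqE/= => ij; rewrite coef_derivn.
  have [ij'|ji] := ltnP i j.
    rewrite [p`_ _]nth_default ?mul0rn ?mulr0//; apply: leq_trans sp _.
    by have := ltn_ord i; lia.
  rewrite [q`_ _]nth_default ?mul0r//; apply: leq_trans sq _.
  by rewrite ltn_neqAle eq_sym ij.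
by rewrite coef_derivn subnKC// -[p`_n *+ _]mulr_natl mulrA.
Qed.

Lemma eigenvalueE (R : realType) (k : nat) (Q : nat -> {poly R[i]}) (n : nat)
    (p : {poly R[i]}) (lambda : R[i]) :
    (forall j, (1 <= j <= k)%N -> (size (Q j) <= j.+1)%N) -> (k <= n)%N ->
    p \is monic -> size p = n.+1 -> diffop k Q p = lambda *: p ->
  lambda = \sum_(1 <= j < k.+1) (Q j)`_j * (n ^_ j)%:R.
Proof.
move=> sQ kn /monicP pm sp /(congr1 (fun q : {poly R[i]} => q`_n)).
have pn : p`_n = 1 by rewrite -pm /lead_coef sp.
rewrite coefZ pn mulr1 => <-; rewrite coef_sum; apply: eq_big_nat => j jk.
by rewrite coef_mul_derivn ?pn ?mulr1 ?sp ?sQ//; lia.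
Qed.

(** The smallest factor is [n - k + 1], and the others are positive. *)
Lemma ltn_sub_ffact (n j k : nat) :
  (j < k <= n)%N -> (n - k < (n - j) ^_ (k - j))%N.
Proof.
case: k => [|k]; first by rewrite ltn0.
move=> /andP[jk kn]; rewrite subSn// ffactnSr.
have : (0 < (n - j) ^_ (k - j))%N by rewrite ffact_gt0; lia.
by move: (_ ^_ _) => m; nia.
Qed.

Lemma ffactD (n j d : nat) : n ^_ (j + d) = (n ^_ j * (n - j) ^_ d)%N.
Proof.
by elim: d => [|d IH]; rewrite ?addn0 ?muln1// addnS !ffactnSr IH subnDA mulnA.
Qed.

Lemma eigenpolynomial_bound (R : realType) (k : nat) (Q : nat -> {poly R[i]})
    (n : nat) (p : {poly R[i]}) (z : R[i]) :
    degenerate_exactly_solvable k Q -> (k <= n)%N -> eigenpolynomial k Q n p ->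
    (forall a, root p a -> `|a| < `|z|) ->
  (n - k).+1%:R * `|(Q k).[z]| <=
    \sum_(1 <= j < k) (`|(Q j).[z]| * (2 * `|z|) ^+ (k - j) +
                       `|(Q j)`_j| * (2 * `|z|) ^+ k).
Proof.
move=> [[_ sQ [j0 j0k _]] sQk] kn [pm sp [lambda pl]] pz.
have k0 : (0 < k)%N by lia.
have lE := eigenvalueE sQ kn pm sp pl.
have x0 : 0 <= 2 * `|z| by rewrite mulr_ge0.
have pzk j : (j < k)%N ->
    (n - k).+1%:R * `|p^`(j).[z]| <= (2 * `|z|) ^+ (k - j) * `|p^`(k).[z]|.
  move=> jk; have := @norm_derivn_ge _ p z j (k - j) _ pz.
  rewrite subnKC ?(ltnW jk)// sp => /(_ ltac:(lia)); apply: le_trans.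
  by rewrite ler_wpM2r// ler_nat ltn_sub_ffact// jk.
have pk_gt0 : 0 < `|p^`(k).[z]|.
  rewrite normr_gt0; apply/negP => rz.
  have kp : (k < size p)%N by rewrite sp.
  by have := root_derivn_norm_lt kp pz rz; rewrite ltxx.
rewrite -(ler_pM2r pk_gt0) mulr_suml.
move: pl; rewrite /diffop big_nat_recr//= => /(congr1 (horner^~ z)).
rewrite hornerD hornerM hornerZ horner_sum => /(canRL (addKr _)).
move: lE; rewrite big_nat_recr//= nth_default// mul0r addr0 => ->.
rewrite -sumrN mulr_suml -big_split/= => Qk.
rewrite -mulrA -normrM Qk.
apply: le_trans (ler_wpM2l (ler0n _ _) (ler_norm_sum _ _ _)) _.
rewrite mulr_sumr; apply: ler_sum_nat => j /andP[j1 jk].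
apply: le_trans (ler_wpM2l (ler0n _ _) (ler_normD _ _)) _.
rewrite mulrDr mulrDl normrN hornerM !normrM lerD//.
  by rewrite mulrCA -[leRHS]mulrA ler_wpM2l// pzk.
rewrite normr_nat mulrCA -!mulrA ler_wpM2l// mulrCA mulrA.
have := @norm_derivn_ge _ p z 0 k _ pz; rewrite add0n subn0 sp.
move=> /(_ ltac:(lia)); apply: le_trans.
(* Splitting [n ^_ k] at [j] leaves a factor [(n - j) ^_ (k - j)], which is at least [n - k + 1]. *)
rewrite ler_wpM2r// -natrM ler_nat -{2}(subnKC (ltnW jk)) ffactD.
rewrite mulnC leq_mul2l ltn_sub_ffact ?orbT//.
by rewrite jk.
Qed.

(** Among [size q] distinct real candidates beyond [A], one is not a root, since a nonzero [q] has
    fewer roots than that. *)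
Lemma exists_nonroot_norm_gt (R : realType) (q : {poly R[i]}) (A : R) :
  q != 0 -> exists2 z, A%:C < `|z| & q.[z] != 0.
Proof.
move=> q0; pose f m : R[i] := (`|A| + m.+1%:R)%:C.
pose s := [seq f m | m <- iota 0 (size q)].
have us : uniq s.
  rewrite map_inj_uniq ?iota_uniq// => m m' [] /addrI /eqP.
  by rewrite eqr_nat => /eqP [].
have /allPn[z /mapP[m _ ->]] : ~~ all (root q) s.
  apply/negP => qs; have := max_poly_roots q0 qs us.
  by rewrite size_map size_iota ltnn.
move=> /rootP/eqP qz; exists (f m) => //.
have fm : A < `|A| + m.+1%:R.
  by apply: le_lt_trans (ler_norm A) _; rewrite ltrDl ltr0n.
rewrite normc_def /= expr0n addr0 sqrtr_sqr ltcR.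
exact: lt_le_trans (ler_norm _).
Qed.

Theorem theorem1 (R : realType) (k : nat) (Q : nat -> {poly R[i]})
    (hT : degenerate_exactly_solvable k Q)
    (p : nat -> {poly R[i]})
    (hp : \forall n \near \oo, eigenpolynomial k Q n (p n)) :
  max_root_modulus (p n) @[n --> \oo] --> +oo.
Proof.
apply/cvgryPge => A; have [[Qk0 _ _] _] := hT.
have [z Az Qkz] := exists_nonroot_norm_gt A Qk0.
set S : R[i] := \sum_(1 <= j < k)
  (`|(Q j).[z]| * (2 * `|z|) ^+ (k - j) + `|(Q j)`_j| * (2 * `|z|) ^+ k).
have Qkz0 : 0 < `|(Q k).[z]| by rewrite normr_gt0.
have [N SN] : exists N : nat, S < N%:R * `|(Q k).[z]|.
  have S0 : 0 <= S.
    apply: sumr_ge0 => j _.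
    by rewrite addr_ge0// mulr_ge0// exprn_ge0// mulr_ge0.
  exists (Num.bound (complex.Re (S / `|(Q k).[z]|))).
  rewrite -ltr_pdivrMr//.
  have : 0 <= S / `|(Q k).[z]| by rewrite divr_ge0.
  (* Nonnegativity in [R[i]] makes the imaginary part zero, so the Archimedean bound in [R]
     applies. *)
  case: (S / _) => a b; rewrite lecE/= => /andP[/eqP -> a0].
  rewrite -[_%:R](rmorph_nat (real_complex R)) ltcR.
  exact: archi_boundP.
near=> n; rewrite leNgt; apply/negP => rA.
have kn : (k <= n)%N by near: n; exists k.
have pn : eigenpolynomial k Q n (p n) by near: n.
(* This makes [n - k + 1] exceed [N], against the bound by [S]. *)
have Nn : (N + k <= n)%N by near: n; exists (N + k)%N.
have [_ sp _] := pn.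
have pz a : root (p n) a -> `|a| < `|z|.
  move=> pa; apply: lt_trans Az.
  rewrite -[`|a|]/((ComplexField.Normc.normc a)%:C) ltcR.
  apply: le_lt_trans rA.
  have sp1 : (1 < size (p n))%N.
    by rewrite sp; case: hT => -[_ _ [j jk _] _]; lia.
  by have [_] := max_root_modulusP sp1; apply.
have := eigenpolynomial_bound hT kn pn pz; rewrite -/S => /le_lt_trans /(_ SN).
by rewrite ltr_pM2r// ltr_nat; lia.
Unshelve. all: by end_near.
Qed.
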